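(* Let $\Lambda$ be an $n$-dimensional lattice of Voronoi's first kind with obtuse superbase $b_1, \dots, b_{n+1}$ and Selling parameters $q_{ij} = b_i \cdot b_j$. Let $G$ be the undirected graph with $n+1$ vertices $v_1, \dots, v_{n+1}$ and edges $e_{ij}$ (joining $v_i$ to $v_j$) with weight $w_{ij} = -q_{ij}$. Let $(C, \bar{C})$ be a minimum cut in the graph $G$, and let $I = \{ i \mid v_i \in C\}$. Then $\sum_{i \in I} b_i$ is a short vector in the lattice $\Lambda$, and the squared Euclidean length of this short vector is equal to the weight $W(C,\bar{C})$ of the minimum cut.
   Context: An $n$-dimensional lattice $\Lambda$ ($n \geq 1$) is the set of all integer linear combinations of $n$ linearly independent vectors (a basis) in $\mathbb{R}^m$, $m \geq n$. The inner product $x \cdot y$ and norm $\|x\|$ are the Euclidean ones. A short vector of $\Lambda$ is a lattice point of minimum nonzero Euclidean length, i.e. an $s \in \Lambda \setminus \{0\}$ with $\|s\|^2 = \min_{x \in \Lambda \setminus \{0\}} \|x\|^2$. The lattice $\Lambda$ is of Voronoi's first kind if it has an obtuse superbase, that is, a set of $n+1$ vectors $b_1, \dots, b_{n+1}$ such that $b_1, \dots, b_n$ is a basis for $\Lambda$, $b_1 + b_2 + \dots + b_{n+1} = 0$, and $q_{ij} = b_i \cdot b_j \leq 0$ for all $i,j \in \{1,\dots,n+1\}$ with $i \neq j$. The numbers $q_{ij}$ are called the Selling parameters. A cut in a graph with vertex set $V$ is a pair $(C, \bar{C})$ of nonempty subsets of $V$ with $C \cap \bar{C} = \emptyset$ and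 $C \cup \bar{C} = V$. For symmetric edge weights $w_{ij} = w_{ji} \in \mathbb{R}$, the weight of the cut is $W(C,\bar{C}) = \sum_{i \in I} \sum_{j \in J} w_{ij}$, where $I = \{ i \mid v_i \in C\}$ and $J = \{ j \mid v_j \in \bar{C}\}$. Weights $w_{ii}$ of loops do not affect the weight of any cut. A minimum cut is a cut $(C,\bar{C})$ minimising $W(C,\bar{C})$ over all cuts. *)

(* Defs.v *)
From mathcomp Require Import classical_sets reals.
From mathcomp Require Import all_boot all_order all_algebra.

Set Implicit Arguments.
Unset Strict Implicit.
Unset Printing Implicit Defensive.

Import Order.TTheory GRing.Theory Num.Theory.
Local Open Scope ring_scope.

Definition dot (R : realType) (m : nat) (x y : 'rV[R]_m) : R :=
  \sum_(k < m) x 0 k * y 0 k.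

(* The norm that the analysis library puts on 'rV[R]_m is the sup norm. *)
Definition enorm (R : realType) (m : nat) (x : 'rV[R]_m) : R :=
  Num.sqrt (dot x x).

Lemma dotC (R : realType) (m : nat) (x y : 'rV[R]_m) : dot x y = dot y x.
Proof. by apply: eq_bigr => k _; rewrite mulrC. Qed.

Definition lattice_basis (R : realType) (m n : nat) (L : set 'rV[R]_m)
    (b : 'I_n -> 'rV[R]_m) : Prop :=
  free [tuple b i | i < n] /\
  L = [set x | exists z : 'I_n -> int, x = \sum_(i < n) b i *~ z i]%classic.

Definition is_lattice (R : realType) (m n : nat) (L : set 'rV[R]_m) : Prop :=
  exists b : 'I_n -> 'rV[R]_m, lattice_basis L b.

Definition short_vector (R : realType) (m : nat) (L : set 'rV[R]_m)
    (s : 'rV[R]_m) : Prop :=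
  [/\ L s, s <> 0 &
      forall x : 'rV[R]_m, L x -> x <> 0 -> enorm s ^+ 2 <= enorm x ^+ 2].

Definition selling (R : realType) (m n : nat) (b : 'I_n.+1 -> 'rV[R]_m)
    (i j : 'I_n.+1) : R :=
  dot (b i) (b j).

(* The vectors b_1, ..., b_{n+1} are indexed by 0, ..., n; the embedding
   [widen_ord (leqnSn n)] of 'I_n into 'I_n.+1 selects the first n of them. *)
Definition obtuse_superbase (R : realType) (m n : nat) (L : set 'rV[R]_m)
    (b : 'I_n.+1 -> 'rV[R]_m) : Prop :=
  [/\ lattice_basis L (fun i : 'I_n => b (widen_ord (leqnSn n) i)),
      \sum_(i < n.+1) b i = 0 &
      forall i j : 'I_n.+1, i != j -> selling b i j <= 0].

(* Undirected graph on V in which every pair of vertices (loops included) is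
   joined by a weighted edge. *)
Record wgraph (R : realType) (V : finType) := WGraph {
  weight : V -> V -> R;
  weight_sym : forall i j : V, weight i j = weight j i
}.

Definition is_cut (V : finType) (C D : {set V}) : Prop :=
  [/\ C != set0, D != set0, C :&: D = set0 & C :|: D = [set: V]].

Definition cut_weight (R : realType) (V : finType) (G : wgraph R V)
    (C D : {set V}) : R :=
  \sum_(i in C) \sum_(j in D) weight G i j.

Definition is_min_cut (R : realType) (V : finType) (G : wgraph R V)
    (C D : {set V}) : Prop :=
  is_cut C D /\
  forall C' D' : {set V}, is_cut C' D' -> cut_weight G C D <= cut_weight G C' D'.

Lemma selling_weight_sym (R : realType) (m n : nat)
    (b : 'I_n.+1 -> 'rV[R]_m) (i j : 'I_n.+1) :
  - selling b i j = - selling b j i.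
Proof. by rewrite /selling dotC. Qed.

(* The vertex v_i is represented by its index i. *)
Definition selling_graph (R : realType) (m n : nat)
    (b : 'I_n.+1 -> 'rV[R]_m) : wgraph R 'I_n.+1 :=
  WGraph (selling_weight_sym b).

(* Main.v *)
(** Selling's formula: if the [b i] sum to zero, then
    |sum_i u_i b_i|^2 = (1/2) sum_(i, j) w_ij (u_i - u_j)^2, where
    w_ij = - b_i . b_j.  When u is the indicator of C this is the weight of the
    cut (C, ~: C).  When u is integral with u_i0 < u_j0, each (u_i - u_j)^2 is
    at least its value for the indicator of C' = {k | u_i0 < u_k}, so, the
    weights being nonnegative, the squared length is at least the weight of the
    cut (C', ~: C'). *)
Require Import Defs.
From mathcomp Require Import classical_sets reals.
From mathcomp Require Import all_boot all_order all_algebra.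
From mathcomp Require Import ring.

Import Order.TTheory GRing.Theory Num.Theory.
Local Open Scope ring_scope.

Lemma sqr_enorm {R : realType} {m : nat} (x : 'rV[R]_m) :
  enorm x ^+ 2 = dot x x.
Proof.
by rewrite sqr_sqrtr //; apply: sumr_ge0 => k _; rewrite -expr2 sqr_ge0.
Qed.

Lemma dot_suml {R : realType} {m : nat} {I : finType} (u : I -> R)
    (b : I -> 'rV[R]_m) (y : 'rV[R]_m) :
  dot (\sum_i u i *: b i) y = \sum_i u i * dot (b i) y.
Proof.
rewrite /dot; under eq_bigr => k _ do rewrite summxE mulr_suml.
rewrite exchange_big; apply: eq_bigr => i _; rewrite mulr_sumr.
by apply: eq_bigr => k _; rewrite mxE mulrA.
Qed.

(** Since the [b i] sum to zero, every row of their Gram matrix sums to zero, so the square terms in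
    the expansion of [(u i - u j) ^+ 2] contribute nothing. *)
Lemma selling_formula {R : realType} {m : nat} {I : finType}
    (b : I -> 'rV[R]_m) (u : I -> R) :
  \sum_i b i = 0 ->
  dot (\sum_i u i *: b i) (\sum_i u i *: b i) *+ 2 =
  \sum_i \sum_j - dot (b i) (b j) * (u i - u j) ^+ 2.
Proof.
move=> b0.
have row0 i : \sum_j dot (b i) (b j) = 0.
  under eq_bigr => j _ do rewrite dotC -[dot _ _]mul1r.
  rewrite -dot_suml; under eq_bigr => j _ do rewrite scale1r.
  by rewrite b0 /dot big1 // => k _; rewrite mxE mul0r.
have sq0 : \sum_i \sum_j dot (b i) (b j) * u i ^+ 2 = 0.
  by rewrite big1 // => i _; rewrite -mulr_suml row0 mul0r.
have sq0' : \sum_i \sum_j dot (b i) (b j) * u j ^+ 2 = 0.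
  rewrite exchange_big -[RHS]sq0; apply: eq_bigr => i _.
  by apply: eq_bigr => j _; rewrite dotC.
have -> : dot (\sum_i u i *: b i) (\sum_i u i *: b i) =
          \sum_i \sum_j dot (b i) (b j) * (u i * u j).
  rewrite dot_suml; apply: eq_bigr => i _.
  rewrite dotC dot_suml mulr_sumr; apply: eq_bigr => j _.
  by rewrite (dotC (b j)); ring.
(* Subtracting the two vanishing sums of squares makes the identity hold term by term. *)
rewrite -[LHS]subr0 -[X in _ - X]sq0 -[LHS]subr0 -[X in _ - _ - X]sq0'.
rewrite -sumrMnl -!sumrB; apply: eq_bigr => i _.
by rewrite -sumrMnl -!sumrB; apply: eq_bigr => j _; ring.
Qed.

Lemma is_cutP {V : finType} (C D : {set V}) :
  is_cut C D <->
  D = ~: C /\ exists i j : V, i \notin C /\ j \in C.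
Proof.
split=> [[/set0Pn[j jC] /set0Pn[i iD] CD0 CDT]|[-> [i [j [iC jC]]]]].
  have DC : D = ~: C.
    apply/setP => k; have /setP/(_ k) := CD0; have /setP/(_ k) := CDT.
    by rewrite !inE; case: (k \in C); case: (k \in D).
  by split=> //; exists i, j; split=> //; rewrite DC inE in iD.
split; last by rewrite setUCr.
- by apply/set0Pn; exists j.
- by apply/set0Pn; exists i; rewrite inE.
- by rewrite setICr.
Qed.

(** The factor 2 arises because each crossing pair occurs in both orders, with equal weights by
    symmetry. *)
Lemma cut_weight_indicator {R : realType} {V : finType} (G : wgraph R V)
    (C : {set V}) :
  cut_weight G C (~: C) *+ 2 =
  \sum_i \sum_j weight G i j * ((i \in C)%:R - (j \in C)%:R) ^+ 2.
Proof.
have cutE : cut_weight G C (~: C) =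
    \sum_i \sum_j weight G i j * ((i \in C) && (j \notin C))%:R.
  rewrite /cut_weight big_mkcond; apply: eq_bigr => i _.
  case: (i \in C); last by rewrite big1 // => j _; rewrite mulr0.
  rewrite big_mkcond; apply: eq_bigr => j _; rewrite inE.
  by case: (j \in C); rewrite /= ?mulr0 ?mulr1.
rewrite mulr2n {2}cutE exchange_big cutE -big_split; apply: eq_bigr => i _.
rewrite -big_split; apply: eq_bigr => j _; rewrite /= (weight_sym G j i).
by case: (i \in C); case: (j \in C) => /=; ring.
Qed.

Lemma sum_indicator {R : realType} {m : nat} {I : finType} (C : {set I})
    (b : I -> 'rV[R]_m) :
  \sum_(i in C) b i = \sum_i (i \in C)%:R *: b i.
Proof.
rewrite big_mkcond; apply: eq_bigr => i _.
by case: (i \in C); rewrite ?scale1r ?scale0r.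
Qed.

(** Shifting all coefficients by a common constant leaves the sum unchanged; the shift by
    [u ord_max] removes the last vector. *)
Lemma sum_superbase {R : realType} {m n : nat} (b : 'I_n.+1 -> 'rV[R]_m)
    (u : 'I_n.+1 -> R) :
  \sum_i b i = 0 ->
  \sum_i u i *: b i =
  \sum_(i < n) (u (widen_ord (leqnSn n) i) - u ord_max) *:
    b (widen_ord (leqnSn n) i).
Proof.
move=> b0; transitivity (\sum_i (u i - u ord_max) *: b i).
  under [RHS]eq_bigr => i _ do rewrite scalerBl.
  by rewrite sumrB -scaler_sumr b0 scaler0 subr0.
by rewrite big_ord_recr /= subrr scale0r addr0.
Qed.

(** After the shift that removes the last vector, freeness of the first [n] forces every difference
    to vanish. *)
Lemma superbase_sum_eq0 {R : realType} {m n : nat} {L : set 'rV[R]_m}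
    {b : 'I_n.+1 -> 'rV[R]_m} (u : 'I_n.+1 -> R) :
  obtuse_superbase L b -> \sum_i u i *: b i = 0 -> forall i, u i = u ord_max.
Proof.
case=> [[/freeP fr _] b0 _]; rewrite sum_superbase // => u0 i.
case: (unliftP ord_max i) => [j ->|-> //].
apply/eqP; rewrite -subr_eq0; apply/eqP.
have -> : lift ord_max j = widen_ord (leqnSn n) j.
  by apply: val_inj; rewrite /= /bump leqNgt ltn_ord.
apply: (fr (fun j => u (widen_ord (leqnSn n) j) - u ord_max)).
rewrite -[RHS]u0; apply: eq_bigr => k _; congr (_ *: _).
by rewrite (nth_map k) ?size_enum_ord // nth_ord_enum.
Qed.

Lemma superbase_coords {R : realType} {m n : nat} {L : set 'rV[R]_m}
    {b : 'I_n.+1 -> 'rV[R]_m} (x : 'rV[R]_m) :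
  obtuse_superbase L b ->
  L x <-> exists z : 'I_n.+1 -> int, x = \sum_i (z i)%:~R *: b i.
Proof.
case=> [[_ ->] b0 _]; split=> [[z ->]|[z ->]] /=.
  (* Basis coordinates are extended by the coefficient 0 at [ord_max]. *)
  exists (fun i => oapp z 0 (unlift ord_max i)).
  rewrite big_ord_recr /= unlift_none scale0r addr0; apply: eq_bigr => i _.
  have -> : widen_ord (leqnSn n) i = lift ord_max i.
    by apply: val_inj; rewrite /= /bump leqNgt ltn_ord.
  by rewrite liftK scaler_int.
exists (fun i => z (widen_ord (leqnSn n) i) - z ord_max).
rewrite sum_superbase //; apply: eq_bigr => i _.
by rewrite -intrB scaler_int.
Qed.

Lemma dot_sum_cut {R : realType} {m n : nat} {b : 'I_n.+1 -> 'rV[R]_m}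
    (C : {set 'I_n.+1}) :
  \sum_i b i = 0 ->
  dot (\sum_(i in C) b i) (\sum_(i in C) b i) =
  cut_weight (selling_graph b) C (~: C).
Proof.
move=> b0; apply/eqP; rewrite -(eqr_pMn2r (n := 2)) //; apply/eqP.
by rewrite sum_indicator selling_formula // cut_weight_indicator.
Qed.

(** The left side is 0 or 1, and it is 0 when [a = c]; distinct integers have squared difference at
    least 1. *)
Lemma sqr_indicator_le {R : realType} (t a c : int) :
  ((t < a)%R%:R - (t < c)%R%:R) ^+ 2 <= (a%:~R - c%:~R) ^+ 2 :> R.
Proof.
have [->|neq_ac] := eqVneq a c; first by rewrite !subrr.
apply: (@le_trans _ _ 1).
  by do 2 case: (t < _); rewrite ?subrr ?subr0 ?sub0r ?sqrrN ?expr1n ?expr0n.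
rewrite -intrB -rmorphXn ler1z -gtz0_ge1.
by rewrite lt_def sqr_ge0 sqrf_eq0 subr_eq0 neq_ac.
Qed.

Lemma cut_weight_le {R : realType} {m n : nat} {L : set 'rV[R]_m}
    {b : 'I_n.+1 -> 'rV[R]_m} (z : 'I_n.+1 -> int) (t : int) :
  obtuse_superbase L b ->
  cut_weight (selling_graph b) [set k | t < z k] (~: [set k | t < z k]) <=
  dot (\sum_i (z i)%:~R *: b i) (\sum_i (z i)%:~R *: b i).
Proof.
case=> _ b0 obt; rewrite -(ler_pMn2r (n := 2)) //.
rewrite selling_formula // cut_weight_indicator.
apply: ler_sum => i _; apply: ler_sum => j _.
(* Loop weights [- dot (b i) (b i)] are not positive, but their terms vanish on both sides. *)
have [->|neq_ij] := eqVneq i j; first by rewrite !subrr.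
rewrite !inE; apply: ler_wpM2l (sqr_indicator_le _ _ _).
by rewrite oppr_ge0 obt.
Qed.

Theorem theorem2 (R : realType) (m n : nat) (hn : (0 < n)%N) (hmn : (n <= m)%N)
    (L : set 'rV[R]_m) (hL : is_lattice n L)
    (b : 'I_n.+1 -> 'rV[R]_m) (hb : obtuse_superbase L b)
    (C D : {set 'I_n.+1}) (hC : is_min_cut (selling_graph b) C D) :
  short_vector L (\sum_(i in C) b i) /\
  enorm (\sum_(i in C) b i) ^+ 2 = cut_weight (selling_graph b) C D.
Proof.
case: hC => /is_cutP[-> [i [j [iC jC]]]] minC; have [_ b0 _] := hb.
rewrite sqr_enorm dot_sum_cut //; split=> //; split.
- apply/(superbase_coords _ hb); exists (fun k => (k \in C)%:R).
  by rewrite sum_indicator; apply: eq_bigr => k _; case: (k \in C).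
(* If the sum were zero, the indicator of [C] would be constant, yet it separates [i] from [j]. *)
- rewrite sum_indicator => /(superbase_sum_eq0 _ hb) cst.
  have := cst i; rewrite -(cst j) jC (negbTE iC) => /eqP.
  by rewrite eq_sym oner_eq0.
move=> x /(superbase_coords _ hb)[z ->] x0; rewrite !sqr_enorm dot_sum_cut //.
(* Constant coordinates would give [x = 0], so two of them differ. *)
have [i' [j' lt_z]] : exists i' j', z i' < z j'.
  case: (pickP [pred p | z p.1 < z p.2]) => [[i' j'] /= ?|no_lt].
    by exists i', j'.
  case: x0; rewrite sum_superbase // big1 // => k _; set k' := widen_ord _ k.
  have := no_lt (k', ord_max); have := no_lt (ord_max, k') => /=.
  by case: ltgtP => // -> _ _; rewrite subrr scale0r.
(* The threshold [z i'] puts [j'] inside the level set and leaves [i'] outside, so the level set is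
   one side of a cut. *)
apply: le_trans (cut_weight_le z (z i') hb); apply: minC; apply/is_cutP.
by split=> //; exists i', j'; rewrite !inE ltxx.
Qed.
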